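(* Let $n\ge 1$ and let $P_n$ be uniformly distributed in $\mathcal{P}_n$. Then \[ \mathbb{P}\bigl(\exists\, Q\in\mathcal{P}_n\setminus\{P_n,P_n^*\}:\ QQ^*\equiv P_nP_n^* \bmod 4\bigr)\le 8\,(3/4)^{\lfloor (n-1)/4\rfloor}. \]
   Context: For $n\ge 1$, $\mathcal{P}_n=\left\{1+\sum_{j=1}^{n-1}p_jx^j+x^n : p_j\in\{0,1\}\right\}\subset\mathbb{Z}[x]$, a set of $2^{n-1}$ polynomials. For a nonzero polynomial $P$, $P^*(x)=x^{\deg P}P(x^{-1})$ is the polynomial with reversed coefficients. Congruence modulo $4$ of polynomials in $\mathbb{Z}[x]$ means coefficientwise congruence modulo $4$. *)

(* Defs.v *)
From mathcomp Require Import all_boot all_order all_algebra finmap.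

Set Implicit Arguments.
Unset Strict Implicit.
Unset Printing Implicit Defensive.

Import Order.TTheory GRing.Theory Num.Theory.

Local Open Scope fset_scope.
Local Open Scope ring_scope.

(* The coefficient of 'X^j, for 1 <= j <= n - 1, is stored at index j - 1. *)
Definition calP (n : nat) : {fset {poly int}} :=
  [fset (1 + \sum_(j < n.-1) (p j)%:R *: 'X^(j.+1) + 'X^n)%R
     | p : {ffun 'I_n.-1 -> bool} in {: {ffun 'I_n.-1 -> bool}}]%fset.

Lemma calPP (n : nat) (P : {poly int}) :
  reflect (exists p : nat -> bool,
             P = 1 + \sum_(1 <= j < n) (p j)%:R *: 'X^j + 'X^n)
          (P \in calP n).
Proof.
have shift (F : nat -> {poly int}) :
    \sum_(1 <= j < n) F j = \sum_(j < n.-1) F j.+1.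
  by rewrite big_add1 big_mkord.
apply: (iffP (imfsetP _ _ _ _)) => [[p _ ->]|[p ->]].
- exists (fun j => if insub j.-1 is Some k then p k else false).
  rewrite shift; congr (_ + _ + _); apply: eq_bigr => j _ /=.
  by rewrite valK.
- exists [ffun j : 'I_n.-1 => p j.+1] => //=.
  rewrite shift; congr (_ + _ + _); apply: eq_bigr => j _ /=.
  by rewrite ffunE.
Qed.

Lemma card_calP (n : nat) : #|` calP n| = (2 ^ n.-1)%N.
Proof.
rewrite /calP card_imfset /=.
  by rewrite -cardE card_ffun card_bool card_ord.
move=> p q /addIr /addrI e; apply/ffunP => k.
have := congr1 (fun P : {poly int} => P`_k.+1) e.
have coefk (r : {ffun 'I_n.-1 -> bool}) :
    (\sum_(j < n.-1) (r j)%:R *: 'X^(j.+1) : {poly int})`_k.+1 = (r k)%:R.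
  rewrite coef_sum (bigD1 k) //= coefZ coefXn eqxx mulr1 big1 ?addr0 // => j njk.
  by rewrite coefZ coefXn eqSS [_ == _]eq_sym (negPf njk : (j == k :> nat) = _) mulr0.
by rewrite !coefk; case: (p k); case: (q k).
Qed.

Definition recip_poly (P : {poly int}) : {poly int} := Poly (rev P).

Lemma recip_polyE (P : {poly int}) :
  recip_poly P = \poly_(i < size P) P`_((size P).-1 - i).
Proof.
apply/polyP => i; rewrite coef_Poly coef_poly; case: ltnP => hi.
  by rewrite nth_rev //; case: (size P) hi => // m _; rewrite subSS.
by rewrite nth_default // size_rev.
Qed.

Definition eqpmod (m : int) (P Q : {poly int}) : bool :=
  P - Q \is a polyOver (dvdz m).

Lemma eqpmodP (m : int) (P Q : {poly int}) :
  reflect (forall i, (P`_i = Q`_i %[mod m])%Z) (eqpmod m P Q).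
Proof.
apply: (iffP polyOverP) => h i; have := h i.
- by rewrite coefB -eqz_mod_dvd => /eqP.
- by move=> e; rewrite coefB -eqz_mod_dvd; apply/eqP.
Qed.

Definition uniform_prob (T : choiceType) (A : {fset T}) (E : pred T) : rat :=
  #|` [fset x in A | E x]%fset|%:R / #|` A|%:R.

(* Main.v *)
(* Write f' for the reversal of f. Modulo 2, unique factorization turns
   PP' = QQ' into P = AB, Q = AB', where A and B are not self-reciprocal because
   Q is neither P nor P'. Replacing Q by Q' exchanges A and B, so one may assume
   k = deg A >= m = deg B. Fix B and reveal the pairs (a_i, a_(k-i)) from the
   outside in. The i-th coefficient of PP' - QQ' modulo 4 depends only on the
   pairs up to i, and, since the coefficients are lifted to 0/1, it restricts the
   i-th pair to a line orthogonal to the slope vector formed by the i-th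
   coefficients of A(B + B') and A'(B + B'), when that vector is nonzero. If d is
   the lowest degree in B + B', the slope at i + d is the i-th pair plus a
   function of the earlier ones, so it vanishes for only one of the four values
   of this pair. A potential giving weight 3 to the vanishing slopes and 2 to the
   others then shows that the number of A grows by a factor at most 3 per pair
   instead of 4, up to a loss (3/2)^(d-1), which is compensated in the sum over B
   since only a fraction of order 2^-d of the B have a given d. Summing over
   k >= n/2 gives the bound. *)

Require Import Defs.
From mathcomp Require Import all_boot all_order all_algebra finmap.
From mathcomp Require Import ring lra zify.

Set Implicit Arguments.
Unset Strict Implicit.
Unset Printing Implicit Defensive.

Import Order.TTheory GRing.Theory Num.Theory.

Local Open Scope fset_scope.
Local Open Scope ring_scope.

(** * Reversal and factorization over F_2 *)

Section Reversal.
Variable R : comNzRingType.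
Implicit Types p q : {poly R}.

(** The degree is prescribed instead of read off [p], so reversal is linear, and multiplicative and
    involutive on polynomials of bounded size. *)
Definition revn (n : nat) p : {poly R} := \poly_(i < n.+1) p`_(n - i).

Lemma coef_revn n p i : (revn n p)`_i = if (i <= n)%N then p`_(n - i) else 0.
Proof. by rewrite coef_poly ltnS. Qed.

Lemma size_revn n p : (size (revn n p) <= n.+1)%N.
Proof. exact: size_poly. Qed.

Lemma revnK n p : (size p <= n.+1)%N -> revn n (revn n p) = p.
Proof.
move=> sp; apply/polyP => i; rewrite !coef_revn leq_subr.
by case: leqP => [/subKn->//|ni]; rewrite nth_default ?(leq_trans sp).
Qed.

Lemma revn0 p : (size p <= 1)%N -> revn 0 p = p.
Proof.
move=> sp; apply/polyP => -[|i]; rewrite coef_revn //.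
by rewrite ltn0 nth_default // (leq_trans sp).
Qed.

Lemma revnM n m p q : (size p <= n.+1)%N -> (size q <= m.+1)%N ->
  revn (n + m) (p * q) = revn n p * revn m q.
Proof.
move=> sp sq.
have -> : p = \sum_(j < n.+1) p`_j *: 'X^j.
  by rewrite -poly_def; apply/polyP => i; rewrite coef_poly; case: ltnP => // ni;
     rewrite nth_default ?(leq_trans sp).
have lin (I : finType) (F : I -> {poly R}) k :
    revn k (\sum_i F i) = \sum_i revn k (F i).
  apply/polyP => i; rewrite coef_revn !coef_sum.
  case: leqP => ik; first by apply: eq_bigr => j _; rewrite coef_revn ik.
  by rewrite big1 // => j _; rewrite coef_revn leqNgt ik.
rewrite mulr_suml !lin mulr_suml; apply: eq_bigr => -[j /=]; rewrite ltnS => jn _.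
have -> : revn n (p`_j *: 'X^j) = p`_j *: 'X^(n - j).
  apply/polyP => i; rewrite coef_revn !coefZ !coefXn.
  case: leqP => ni; first by congr (_ * _%:R); apply/eqP/eqP; lia.
  by rewrite (_ : i == _ = false) ?mulr0 //; apply/eqP; lia.
rewrite -!scalerAl; apply/polyP => i; rewrite coef_revn !coefZ !coefXnM coef_revn.
case: (leqP i (n + m)) => inm; last first.
  by case: ltnP => ?; rewrite ?mulr0 //; case: leqP => ?; rewrite ?mulr0 //; lia.
case: (ltnP i (n - j)) => i1.
  case: ltnP => i2; first by [].
  by rewrite [q`__]nth_default ?mulr0 // (leq_trans sq) //; lia.
case: ltnP => i2.
  by case: leqP => ?; rewrite ?mulr0 //; lia.
case: leqP => i3; last lia.
by congr (_ * _`_ _); lia.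
Qed.

End Reversal.

Lemma F2_eq01 (x : 'F_2) : x = 0 \/ x = 1.
Proof. by case: x => [[|[|//]] ?]; [left|right]; exact: val_inj. Qed.

Lemma F2_neq0 (x : 'F_2) : x != 0 -> x = 1.
Proof. by case: (F2_eq01 x) => [->|->//]; rewrite eqxx. Qed.

Lemma F2_eqp (p q : {poly 'F_2}) : p %= q -> p = q.
Proof.
case/eqpP=> -[c1 c2] /= /andP[/F2_neq0-> /F2_neq0->].
by rewrite !scale1r.
Qed.

(* [A] is the gcd of [p] and [q]: after dividing it out, the two cofactors
   are coprime, so each one divides the reversal of the other. *)
Lemma F2_reciprocal_factor (n : nat) (p q : {poly 'F_2}) :
    size p = n.+1 -> size q = n.+1 -> p`_0 = 1 -> q`_0 = 1 ->
    p * revn n p = q * revn n q ->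
  exists k m (A B : {poly 'F_2}),
    [/\ (k + m = n)%N, size A = k.+1 /\ size B = m.+1,
        A`_0 = 1 /\ B`_0 = 1 & p = A * B /\ q = A * revn m B].
Proof.
move=> sp sq p0 q0 E.
have pn0 : p != 0 by rewrite -size_poly_gt0 sp.
have [A AE] : exists A : {poly 'F_2}, A = gcdp p q by exists (gcdp p q).
have [B BE] : exists B : {poly 'F_2}, B = p %/ A by exists (p %/ A).
have [C CE] : exists C : {poly 'F_2}, C = q %/ A by exists (q %/ A).
have pE : p = A * B by rewrite mulrC ?BE ?CE divpK // AE dvdp_gcdl.
have qE : q = A * C by rewrite mulrC ?BE ?CE divpK // AE dvdp_gcdr.
have cBC : coprimep B C by rewrite BE CE AE; apply: coprimep_div_gcd; rewrite pn0.
have unit2 (x y : 'F_2) : x * y = 1 -> x = 1 /\ y = 1.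
  by case: (F2_eq01 x) => ->; case: (F2_eq01 y) => ->; rewrite ?mul0r ?mulr0.
have [A0 B0] : A`_0 = 1 /\ B`_0 = 1 by apply: unit2; rewrite -coef0M -pE.
have [_ C0] : A`_0 = 1 /\ C`_0 = 1 by apply: unit2; rewrite -coef0M -qE.
have nz (f : {poly 'F_2}) : f`_0 = 1 -> f != 0.
  by move=> f0; apply/eqP => fE; move: f0; rewrite fE coef0.
have spos (f : {poly 'F_2}) : f`_0 = 1 -> size f = (size f).-1.+1.
  by move=> /nz; rewrite -size_poly_gt0; case: size.
have revnz (f : {poly 'F_2}) : f`_0 = 1 -> revn (size f).-1 f != 0.
  move=> f0; apply/eqP => /(congr1 (fun g : {poly 'F_2} => g`_(size f).-1)).
  by rewrite coef_revn leqnn subnn coef0 f0.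
have [An0 Bn0 Cn0] := And3 (nz _ A0) (nz _ B0) (nz _ C0).
have sAB : ((size A).-1 + (size B).-1 = n)%N.
  by move: sp; rewrite pE size_mul // (spos _ A0) (spos _ B0) /=; lia.
have sCB : size C = size B.
  move: sq; rewrite qE size_mul // (spos _ A0) (spos _ C0) => sAC.
  by rewrite (spos _ B0) (spos _ C0); lia.
exists (size A).-1, (size B).-1, A, B.
split => //; first by split; apply: spos.
split=> //; rewrite {1}qE; congr (_ * _).
have E' : B * revn (size B).-1 B = C * revn (size B).-1 C.
  apply: (@mulfI _ (A * revn (size A).-1 A)).
    by rewrite mulf_neq0 // revnz.
  have sz (f : {poly 'F_2}) : f`_0 = 1 -> (size f <= (size f).-1.+1)%N.
    by move/spos => <-.
  rewrite mulrACA [RHS]mulrACA -!revnM ?sz // -?pE -?qE -?sCB ?sz //.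
  by rewrite sCB [((size A).-1 + _)%N]sAB.
have dB : B %| revn (size B).-1 C.
  by rewrite -(Gauss_dvdpr _ cBC) -E' dvdp_mulr.
have rC : revn (size B).-1 C != 0 by rewrite -sCB revnz.
(* [B] divides a nonzero polynomial of size at most [size B], so the two are associates, and over
   ['F_2] associates are equal. *)
have -> : B = revn (size B).-1 C.
  apply: F2_eqp; rewrite -dvdp_size_eqp // eqn_leq (dvdp_leq rC dB) /=.
  by rewrite {2}(spos _ B0) size_revn.
have -> : size (revn (size B).-1 C) = size B.
  apply/eqP; rewrite eqn_leq (dvdp_leq rC dB) andbT.
  by rewrite {2}(spos _ B0) size_revn.
by rewrite revnK // -spos // sCB.
Qed.

(** * The condition modulo 4 *)

Definition agree (R : nzRingType) (N : nat) (f g : {poly R}) :=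
  forall i, (i < N)%N -> f`_i = g`_i.

Lemma agreeM (R : nzRingType) (N : nat) (f f' g g' : {poly R}) :
  agree N f f' -> agree N g g' -> agree N (f * g) (f' * g').
Proof.
move=> ff gg i iN; rewrite !coefM; apply: eq_bigr => -[j /= ji] _.
by rewrite ff ?gg //; lia.
Qed.

(** The intermediate terms of the two convolutions coincide; for [0 < i] the two extreme terms are
    distinct and carry the whole difference. *)
Lemma coefM_agree (R : comNzRingType) (i : nat) (f f' g g' : {poly R}) :
    (0 < i)%N -> agree i f f' -> agree i g g' ->
  (f' * g')`_i - (f * g)`_i =
    (f'`_i - f`_i) * g`_0 + f`_0 * (g'`_i - g`_i).
Proof.
case: i => // i _ ff gg; rewrite !coefM.
rewrite [X in X - _]big_ord_recr [X in _ - X = _]big_ord_recr /=.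
rewrite [X in X + _ - _]big_ord_recl [X in _ - (X + _)]big_ord_recl /=.
rewrite !subn0 !subnn -(ff 0) // -(gg 0) //.
rewrite (eq_bigr (fun j : 'I_i => f`_(bump 0 j) * g`_(i.+1 - bump 0 j))).
  by ring.
move=> [j /= ji] _; rewrite -ff -?gg // /bump; lia.
Qed.

(** Used for [int], ['Z_4] and ['F_2] itself. The first two lifts are not additive, and this defect
    carries the information beyond parity. *)
Definition lift01 (R : nzRingType) (f : {poly 'F_2}) : {poly R} :=
  map_poly (fun x : 'F_2 => (x : nat)%:R) f.

Lemma coef_lift01 (R : nzRingType) (f : {poly 'F_2}) i :
  (lift01 R f)`_i = (nat_of_ord f`_i)%:R.
Proof. by rewrite coef_map_id0. Qed.

Lemma agree_lift01 (R : nzRingType) (N : nat) (f g : {poly 'F_2}) :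
  agree N f g -> agree N (lift01 R f) (lift01 R g).
Proof. by move=> fg i iN; rewrite !coef_lift01 fg. Qed.

(* With [As], [Bs] the reversals of [A], [B], this says that the lifts of
   [A * B] and [A * Bs] have the same autocorrelation modulo 4, up to order [N]. *)
Definition autocorr4 (N : nat) (B Bs A As : {poly 'F_2}) : bool :=
  [forall i : 'I_N,
     (lift01 'Z_4 (A * B) * lift01 'Z_4 (As * Bs))`_i
       == (lift01 'Z_4 (A * Bs) * lift01 'Z_4 (As * B))`_i].

Lemma autocorr4_agree (N : nat) (B Bs A As A' As' : {poly 'F_2}) :
  agree N A A' -> agree N As As' ->
  autocorr4 N B Bs A As -> autocorr4 N B Bs A' As'.
Proof.
move=> AA AAs /forallP h; apply/forallP => i; move: (h i).
suff E (f g : {poly 'F_2}) :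
    agree N (lift01 'Z_4 (A * f) * lift01 'Z_4 (As * g))
            (lift01 'Z_4 (A' * f) * lift01 'Z_4 (As' * g)).
  by rewrite !E.
by apply: agreeM; apply: agree_lift01; apply: agreeM.
Qed.

(** This symmetry lets the factor of larger degree play the role of [A]. *)
Lemma autocorr4_swap (N : nat) (B Bs A As : {poly 'F_2}) :
  autocorr4 N B Bs A As = autocorr4 N A As B Bs.
Proof.
apply: eq_forallb => i; rewrite (mulrC A B) (mulrC As Bs); congr (_ == _`_ _).
by rewrite mulrC (mulrC A) (mulrC As).
Qed.

(** The hypothesis amounts to [2 * (x * (a - c) + y * (b - d)) = 0] modulo 4; halving it leaves an
    equation modulo 2, where signs disappear. *)
Lemma lift01_increment (a b c d x y : 'F_2) :
    let t (z : 'F_2) : 'Z_4 := (z : nat)%:R in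
    t (a + x) - t a + (t (b + y) - t b) = t (c + x) - t c + (t (d + y) - t d) ->
  x * (a + c) + y * (b + d) = 0.
Proof.
by case: (F2_eq01 a) => ->; case: (F2_eq01 b) => ->; case: (F2_eq01 c) => ->;
   case: (F2_eq01 d) => ->; case: (F2_eq01 x) => ->; case: (F2_eq01 y) => ->;
   move=> /= e; apply/eqP; move/eqP: e.
Qed.

(* Changing the [i]-th coefficients of [A] and [As] only changes the extreme
   terms of the [i]-th coefficients of the two products; [0/1] lifts turn an
   increment [x] of a bit [a] into [(1 - 2a) x]. *)
Lemma autocorr4_pair (i N : nat) (B Bs A As A' As' : {poly 'F_2}) :
    (0 < i < N)%N -> B`_0 = 1 -> Bs`_0 = 1 -> A`_0 = 1 -> As`_0 = 1 ->
    agree i A A' -> agree i As As' ->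
    autocorr4 N B Bs A As -> autocorr4 N B Bs A' As' ->
  (A'`_i - A`_i) * (A * (B + Bs))`_i + (As'`_i - As`_i) * (As * (B + Bs))`_i = 0.
Proof.
case/andP=> i0 iN B0 Bs0 A0 As0 AA AAs.
move=> /forallP/(_ (Ordinal iN))/eqP /= h /forallP/(_ (Ordinal iN))/eqP /= h'.
have {h h'} := congr2 (fun u v => u - v) h' h.
have inc (f f' g : {poly 'F_2}) : agree i f f' -> g`_0 = 1 ->
    (f' * g)`_i = (f * g)`_i + (f'`_i - f`_i).
  move=> ff g0; apply/eqP; rewrite addrC -subr_eq; apply/eqP.
  by rewrite coefM_agree // subrr mulr0 addr0 g0 mulr1.
have one (f g : {poly 'F_2}) : f`_0 = 1 -> g`_0 = 1 -> (lift01 'Z_4 (f * g))`_0 = 1.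
  by move=> f0 g0; rewrite coef_lift01 coef0M f0 g0.
rewrite !coefM_agree //; try by apply: agree_lift01; apply: agreeM.
rewrite !one // !mul1r !mulr1 !coef_lift01.
rewrite !(inc A A') // !(inc As As') // => /lift01_increment.
by rewrite !(mulrDr _ B Bs) !coefD [(As * Bs)`_i + _]addrC.
Qed.

(** * Counting words from the outside in *)

Fixpoint words (T : finType) (r : nat) : seq (seq T) :=
  if r is r'.+1 then [seq x :: s | x <- enum T, s <- words T r'] else [:: [::]].

Lemma mem_words (T : finType) r (s : seq T) : (s \in words T r) = (size s == r).
Proof.
elim: r s => [|r IHr] [|x s] //=.
  by apply/allpairsPdep => -[? [? []]].
rewrite eqSS -IHr; apply/allpairsPdep/idP => [[y [t [_ h [_ ->]]]]//|h].
by exists x, s; rewrite mem_enum.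
Qed.

Lemma size_words (T : finType) r : size (words T r) = (#|T| ^ r)%N.
Proof. by elim: r => //= r IHr; rewrite size_allpairs IHr -cardE expnS. Qed.

Lemma count_words (T : finType) r (P : pred (seq T)) :
  count P (words T r.+1) = (\sum_x count (fun s => P (x :: s)) (words T r))%N.
Proof.
rewrite /= count_flatten -map_comp sumnE big_map -big_enum /=.
by apply: eq_bigr => x _ /=; rewrite count_map.
Qed.

Definition bpoly (s : seq bool) : {poly 'F_2} := Poly [seq (nat_of_bool b)%:R | b <- s].

Lemma coef_bpoly s i : (bpoly s)`_i = (nth false s i : nat)%:R.
Proof.
rewrite coef_Poly; case: (ltnP i (size s)) => si; first by rewrite (nth_map false).
by rewrite !nth_default ?size_map.
Qed.

Lemma bpoly_rcons s b : bpoly (rcons s b) = bpoly s + (nat_of_bool b)%:R *: 'X^(size s).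
Proof.
apply/polyP => i; rewrite coefD coefZ coefXn !coef_bpoly nth_rcons.
case: ltngtP => si; rewrite ?mulr0 ?addr0 //.
  by rewrite nth_default // ltnW.
by rewrite nth_default ?si // mulr1 add0r.
Qed.

Lemma agree_bpoly_cat s t : agree (size s) (bpoly s) (bpoly (s ++ t)).
Proof. by move=> i si; rewrite !coef_bpoly nth_cat si. Qed.

Lemma big_bool2 (R : Type) (idx : R) (op : Monoid.com_law idx) (F : bool * bool -> R) :
  \big[op/idx]_x F x =
    op (op (F (true, true)) (F (true, false))) (op (F (false, true)) (F (false, false))).
Proof.
rewrite (eq_bigr (fun x => F (x.1, x.2))) => [|[]//].
by rewrite -(pair_bigA _ (fun a b => F (a, b))) /= !big_bool.
Qed.

(* If [u = v = 0] the sum is at most [3 + 2 + 2 + 2]; otherwise [al] holds on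
   at most two points and the sum is at most [3 + 2]. *)
Lemma weighted_choices (al : pred (bool * bool)) (u v : 'F_2) (x1 : bool * bool) :
    (forall x y, al x -> al y ->
      ((nat_of_bool y.1)%:R - (nat_of_bool x.1)%:R) * u
        + ((nat_of_bool y.2)%:R - (nat_of_bool x.2)%:R) * v = 0) ->
  (\sum_x al x * (if x == x1 then 3 else 2)
     <= 3 * (if (u == 0%R) && (v == 0%R) then 3 else 2))%N.
Proof.
move=> H; rewrite big_bool2.
move: (H (true, true) (true, false)) (H (true, true) (false, true))
      (H (true, true) (false, false)) (H (true, false) (false, true))
      (H (true, false) (false, false)) (H (false, true) (false, false)) => /=.
case: (al (true, true)); case: (al (true, false));
  case: (al (false, true)); case: (al (false, false)) => //=;
  case: (F2_eq01 u) => ->; case: (F2_eq01 v) => -> => h1 h2 h3 h4 h5 h6;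
  try (by have := h1 isT isT); try (by have := h2 isT isT);
  try (by have := h3 isT isT); try (by have := h4 isT isT);
  try (by have := h5 isT isT); try (by have := h6 isT isT);
  by case: x1 => [[] []].
Qed.

Section OutsideIn.

Variables (B Bs : {poly 'F_2}) (d : nat).
Hypotheses (B0 : B`_0 = 1) (Bs0 : Bs`_0 = 1).
Hypotheses (BBs_low : forall t, (t < d)%N -> (B + Bs)`_t = 0).
Hypotheses (BBs_d : (B + Bs)`_d = 1).

Implicit Types (l s : seq (bool * bool)).

(* The [j]-th entry of [l] stands for the coefficients of [A] and of its
   reversal in degree [j]. *)
Definition good_prefix l :=
  autocorr4 (size l) B Bs (bpoly (unzip1 l)) (bpoly (unzip2 l)).

Definition slope l j : 'F_2 * 'F_2 :=
  ((bpoly (unzip1 l) * (B + Bs))`_j, (bpoly (unzip2 l) * (B + Bs))`_j).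

(** The values satisfy [3 + 2 + 2 + 2 <= 3 * 3] and [3 + 2 <= 3 * 2], the two cases of one revealed
    pair; hence growth by 3. *)
Definition slope_weight l j : nat :=
  (if (slope l j).1 == 0%R then if (slope l j).2 == 0%R then 3 else 2 else 2)%N.

Lemma slope_rcons l x j :
  slope (rcons l x) j =
    ((slope l j).1 + (x.1 : nat)%:R * (if (j < size l)%N then 0 else (B + Bs)`_(j - size l)),
     (slope l j).2 + (x.2 : nat)%:R * (if (j < size l)%N then 0 else (B + Bs)`_(j - size l))).
Proof.
rewrite /slope /unzip1 /unzip2 !map_rcons !bpoly_rcons.
by rewrite !mulrDl -!scalerAl !coefD !coefZ !coefXnM !size_map !coefD.
Qed.

Lemma slope_weight_rcons l x j : (j < size l + d)%N ->
  slope_weight (rcons l x) j = slope_weight l j.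
Proof.
move=> jd; rewrite /slope_weight slope_rcons.
have -> : (if (j < size l)%N then 0 else (B + Bs)`_(j - size l)) = 0.
  by case: ltnP => // lj; rewrite BBs_low //; lia.
by rewrite !mulr0 !addr0.
Qed.

(** In this degree the new pair is added to the slope with coefficient 1; over ['F_2] only the pair
    equal to the slope cancels it. *)
Lemma slope_weight_rcons_size l x :
  slope_weight (rcons l x) (size l + d) =
    if x == ((slope l (size l + d)).1 != 0, (slope l (size l + d)).2 != 0)
    then 3%N else 2%N.
Proof.
rewrite /slope_weight slope_rcons ltnNge leq_addr addKn BBs_d.
case: (slope l _) => u v; case: x => b c /=.
by case: b; case: c; case: (F2_eq01 u) => ->; case: (F2_eq01 v) => ->.
Qed.

(** Both words are cut after the first pair following [l], where the condition persists, and
    compared in degree [size l]. *)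
Lemma good_prefix_ext l x s s' y :
    (0 < size l)%N -> (bpoly (unzip1 l))`_0 = 1 -> (bpoly (unzip2 l))`_0 = 1 ->
    good_prefix (l ++ x :: s) -> good_prefix (l ++ y :: s') ->
  ((nat_of_bool y.1)%:R - (nat_of_bool x.1)%:R) * (slope l (size l)).1
    + ((nat_of_bool y.2)%:R - (nat_of_bool x.2)%:R) * (slope l (size l)).2 = 0.
Proof.
move=> l0 A0 As0 gx gy.
have trunc z t : good_prefix (l ++ z :: t) ->
  autocorr4 (size l).+1 B Bs (bpoly (unzip1 (rcons l z))) (bpoly (unzip2 (rcons l z))).
  rewrite /good_prefix -cat_rcons => g.
  have {g} : autocorr4 (size l).+1 B Bs (bpoly (unzip1 (rcons l z ++ t)))
                                 (bpoly (unzip2 (rcons l z ++ t))).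
    apply/forallP => -[i /= ii]; move/forallP: g.
    rewrite size_cat size_rcons => g.
    have ii' : (i < (size l).+1 + size t)%N by lia.
    exact: (g (Ordinal ii')).
  apply: autocorr4_agree => i ii; rewrite /unzip1 /unzip2 map_cat;
    by rewrite -agree_bpoly_cat // size_map size_rcons.
have agr z (f : bool * bool -> bool) :
    agree (size l) (bpoly (map f l)) (bpoly (map f (rcons l z))).
  by rewrite map_rcons -cats1 -[X in agree X](size_map f); apply: agree_bpoly_cat.
have agr2 (f : bool * bool -> bool) :
    agree (size l) (bpoly (map f (rcons l x))) (bpoly (map f (rcons l y))).
  by move=> i il; rewrite -!agr.
have := autocorr4_pair (i := size l) (N := (size l).+1) _ B0 Bs0 _ _
          (agr2 fst) (agr2 snd) (trunc _ _ gx) (trunc _ _ gy).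
rewrite l0 ltnS leqnn -(agr x fst 0) // -(agr x snd 0) // => /(_ isT A0 As0).
(* [B + Bs] has constant term [1 + 1 = 0], so [d > 0] and the slope in degree [size l] is determined
   by [l]. *)
have d0 : (0 < d)%N.
  by case: d BBs_d => // /eqP; rewrite coefD B0 Bs0.
have sl : slope (rcons l x) (size l) = slope l (size l).
  rewrite slope_rcons ltnn subnn BBs_low // !mulr0 !addr0.
  by case: slope.
have := sl; rewrite /slope => -[-> ->].
have top z (f : bool * bool -> bool) :
    (bpoly (map f (rcons l z)))`_(size l) = (nat_of_bool (f z))%:R.
  by rewrite coef_bpoly map_rcons nth_rcons size_map ltnn eqxx.
by rewrite !top.
Qed.

(* The [d] slopes following a prefix [l] are already determined by [l]: the
   product of their weights is the potential of [l]. Revealing the next pair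
   consumes the first of them and determines a new one, which vanishes for only
   one of the four values of the pair. *)
Lemma count_good_ext r l :
    (0 < size l)%N -> (bpoly (unzip1 l))`_0 = 1 -> (bpoly (unzip2 l))`_0 = 1 ->
  (count (fun s => good_prefix (l ++ s)) (words (bool * bool)%type r) * 2 ^ d
     <= 3 ^ r * \prod_(j < d) slope_weight l (size l + j))%N.
Proof.
have w2 l' j : (2 <= slope_weight l' j)%N.
  by rewrite /slope_weight; case: eqP => // _; case: eqP.
elim: r l => [|r IHr] l l0 A0 As0.
  (* At most the empty word is counted, and each of the [d] weights is at least 2. *)
  rewrite /= cats0 addn0 expn0 mul1n -[d in (2 ^ d)%N]card_ord -prod_nat_const.
  case: good_prefix; rewrite ?mul1n ?mul0n //.
  exact: leq_prod.
have d0 : (0 < d)%N.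
  by case: d BBs_d => // /eqP; rewrite coefD B0 Bs0.
rewrite count_words big_distrl /=.
(* [al] selects the pairs with some good continuation, the others contributing 0; [K] gathers the
   factors common to all choices of the pair. *)
set al := fun x => has (fun s => good_prefix (l ++ x :: s)) (words (bool * bool)%type r).
set K := (3 ^ r * \prod_(j < d.-1) slope_weight l (size l + j.+1))%N.
set x1 := ((slope l (size l + d)).1 != 0, (slope l (size l + d)).2 != 0).
have step x : (count (fun s => good_prefix (l ++ x :: s)) (words (bool * bool)%type r) * 2 ^ d
    <= K * (al x * if x == x1 then 3 else 2))%N.
  rewrite /al has_count; case: posnP => [->|_]; first by rewrite mul0n.
  rewrite mul1n.
  have agr (f : bool * bool -> bool) : (bpoly (map f (rcons l x)))`_0 = (bpoly (map f l))`_0.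
    by rewrite map_rcons -cats1 -agree_bpoly_cat // size_map.
  have := IHr (rcons l x); rewrite size_rcons !agr => /(_ isT A0 As0).
  rewrite (@eq_count _ _ (fun s => good_prefix (l ++ x :: s))); last first.
    by move=> s; rewrite cat_rcons.
  move/leq_trans; apply.
  rewrite -[d in X in (X <= _)%N](prednK d0) big_ord_recr /= mulnA.
  rewrite addSnnS (prednK d0) slope_weight_rcons_size -/x1 /K leq_mul2r leq_mul2l.
  apply/orP; right; apply/orP; right; apply: leq_prod => i _.
  by rewrite addSnnS slope_weight_rcons //; have := ltn_ord i; lia.
apply: leq_trans (leq_sum _ (fun x _ => step x)) _.
rewrite -big_distrr /=.
have H x y : al x -> al y ->
  ((nat_of_bool y.1)%:R - (nat_of_bool x.1)%:R) * (slope l (size l)).1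
    + ((nat_of_bool y.2)%:R - (nat_of_bool x.2)%:R) * (slope l (size l)).2 = 0.
  by move=> /hasP[s _ gs] /hasP[t _ gt]; apply: good_prefix_ext gs gt.
apply: leq_trans (leq_mul (leqnn K) (weighted_choices x1 H)) _.
rewrite -[d in X in (_ <= X)%N](prednK d0) big_ord_recl /= addn0 /K expnS.
rewrite [X in (_ * (3 * X) <= _)%N](_ : _ = slope_weight l (size l)).
  rewrite -[X in (_ <= X)%N]/(_ * (_ * \prod_(j < d.-1) slope_weight l (size l + j.+1)))%N.
  set pr := (\prod_(j < _) _)%N.
  by move: (3 ^ r)%N pr (slope_weight _ _) => a b c; lia.
by rewrite /slope_weight; case: eqP.
Qed.

End OutsideIn.

(* The coefficients [a_0 .. a_k] are read as the pairs [(a_j, a_(k-j))] for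
   [2 * j < k], together with the middle one [c] when [k] is even. *)
Definition unfold_word (l : seq (bool * bool)) (c : seq bool) : seq bool :=
  unzip1 l ++ c ++ rev (unzip2 l).

Lemma size_unfold_word l c : size (unfold_word l c) = ((size l).*2 + size c)%N.
Proof. by rewrite !size_cat size_rev !size_map -addnn; lia. Qed.

Lemma rev_unfold_word l c :
  rev (unfold_word l c) = unzip2 l ++ rev c ++ rev (unzip1 l).
Proof. by rewrite /unfold_word !rev_cat revK catA. Qed.

Lemma unfold_wordP (s : seq bool) : exists l c,
  [/\ s = unfold_word l c, size l = (size s)./2 & size c = odd (size s)].
Proof.
set h := (size s)./2.
have hs : (h + h + odd (size s) = size s)%N.
  by rewrite addnn addnC odd_double_half.
exists (zip (take h s) (take h (rev s))), (drop h (take (size s - h) s)).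
have s1 : size (take h s) = h by rewrite size_take; case: ltnP => //; lia.
have s2 : size (take h (rev s)) = h by rewrite size_take size_rev; case: ltnP => //; lia.
split.
- rewrite /unfold_word unzip1_zip ?s1 ?s2 // unzip2_zip ?s1 ?s2 //.
  rewrite take_rev revK -{1}(cat_take_drop (size s - h) s).
  rewrite catA; congr (_ ++ _).
  by rewrite -(@take_takel _ h (size s - h)) ?cat_take_drop //; lia.
- by rewrite size_zip s1 s2 minnn.
- by rewrite size_drop size_take; case: ltnP => //; lia.
Qed.

Lemma size_lead_F2 (A : {poly 'F_2}) k : size A = k.+1 -> A`_k = 1.
Proof.
move=> sA; apply: F2_neq0.
by rewrite -[k]/(k.+1.-1) -sA -lead_coefE lead_coef_eq0 -size_poly_gt0 sA.
Qed.

Lemma revn_bpoly k s : size s = k.+1 -> revn k (bpoly s) = bpoly (rev s).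
Proof.
move=> ss; apply/polyP => i; rewrite coef_revn !coef_bpoly.
case: leqP => ik; first by rewrite nth_rev ss ?subSS.
by rewrite nth_default // size_rev ss.
Qed.

Lemma bpoly_surj (A : {poly 'F_2}) k : size A = k.+1 ->
  exists2 s, size s = k.+1 & A = bpoly s.
Proof.
move=> sA; exists [seq x != 0 | x : 'F_2 <- A]; first by rewrite size_map.
apply/polyP => i; rewrite coef_bpoly; case: (ltnP i (size A)) => iA.
  by rewrite (nth_map 0) //; case: (F2_eq01 A`_i) => ->.
by rewrite !nth_default ?size_map.
Qed.

(** For [k > 0], the number of [j > 0] with [2 * j < k]; the extreme pair, always [(true, true)], is
    kept apart. *)
Definition outer_size (k : nat) := k.-1./2.

Lemma outer_sizeE k : (0 < k)%N -> ((outer_size k).*2 + odd k.+1 = k.-1)%N.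
Proof.
by case: k => // k _; rewrite /outer_size /= negbK addnC odd_double_half.
Qed.

Lemma bpoly_unfold_surj (A : {poly 'F_2}) k :
    (0 < k)%N -> size A = k.+1 -> A`_0 = 1 ->
  exists l c, [/\ l \in words (bool * bool)%type (outer_size k),
    c \in words bool (odd k.+1) & A = bpoly (unfold_word ((true, true) :: l) c)].
Proof.
move=> k0 sA A0; have [s ss As] := bpoly_surj sA.
have [l [c [sE sl sc]]] := unfold_wordP s.
have h : (size l = (outer_size k).+1)%N.
  by rewrite sl ss /outer_size; case: k k0 {sA ss} => // k _; rewrite /= uphalfE.
have Ak := size_lead_F2 sA.
have Ar : (revn k A)`_0 = 1 by rewrite coef_revn leq0n subn0.
move: A0 Ar; rewrite As revn_bpoly // sE rev_unfold_word /unfold_word.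
rewrite /unzip1 /unzip2 -!agree_bpoly_cat ?size_map ?h //.
case: l h sl sE => // -[a b] l [h] _ sE; rewrite !coef_bpoly /= => a1 b1.
have [aE bE] : a = true /\ b = true by case: a b a1 b1 {sE} => -[].
exists l, c; rewrite !mem_words h sc ss !eqxx; split=> //.
by rewrite aE bE.
Qed.

(** * Dependence on the first asymmetric pair of [B] *)

Definition asym (x : bool * bool) := x.1 != x.2.

Lemma unfold_word_palindrome l c : (size c <= 1)%N ->
  ~~ has asym l -> rev (unfold_word l c) = unfold_word l c.
Proof.
move=> c1 nl; rewrite rev_unfold_word /unfold_word.
have -> : rev c = c by case: c c1 => [|x []].
have -> // : unzip1 l = unzip2 l.
elim: l nl => //= -[a b] l IHl; rewrite negb_or /asym /= negbK.
by case/andP=> /eqP-> /IHl->.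
Qed.

(** The lowest degree of [B + Bs] is [d = find asym lb + 1], shifted by the extreme pair. Of the [d]
    initial weights the last is 2, as its slope is [(1, 1)], and the others are at most 3, so the
    loss is only [(3 / 2) ^+ (d - 1)]. *)
Lemma count_good_prefix (lb : seq (bool * bool)) (cb : seq bool) r :
    has asym lb ->
    let s := unfold_word ((true, true) :: lb) cb in
  (count (fun la => good_prefix (bpoly s) (bpoly (rev s)) ((true, true) :: la))
     (words (bool * bool)%type r))%:R
    <= 3 ^+ r * (3 / 2) ^+ find asym lb :> rat.
Proof.
move=> hlb; cbv zeta; set s := unfold_word _ cb; set e := find asym lb; set B := bpoly s; set Bs := bpoly (rev s).
have BE t : (t <= size lb)%N -> B`_t = (nat_of_bool (nth (true, true) ((true, true) :: lb) t).1)%:R.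
  move=> tl; rewrite /B /s /unfold_word -agree_bpoly_cat ?size_map //= coef_bpoly.
  congr (_%:R); rewrite -[true :: _]/(unzip1 ((true, true) :: lb)).
  by rewrite (nth_map (true, true)).
have BsE t : (t <= size lb)%N -> Bs`_t = (nat_of_bool (nth (true, true) ((true, true) :: lb) t).2)%:R.
  move=> tl; rewrite /Bs /s rev_unfold_word -agree_bpoly_cat ?size_map //= coef_bpoly.
  congr (_%:R); rewrite -[true :: _]/(unzip2 ((true, true) :: lb)).
  by rewrite (nth_map (true, true)).
have elt : (e < size lb)%N by rewrite -has_find.
have low t : (t < e.+1)%N -> (B + Bs)`_t = 0.
  move=> te; rewrite coefD BE ?BsE //; try by lia.
  case: t te => [|t] te; first exact: val_inj.
  have /= := before_find (true, true) (te : (t < find asym lb)%N).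
  by rewrite /asym; case: nth => -[] [] //= _; apply: val_inj.
have top : (B + Bs)`_(e.+1) = 1.
  rewrite coefD BE ?BsE //=.
  by have /= := nth_find (true, true) hlb; rewrite /asym; case: nth => -[] [] //= _; apply: val_inj.
have B0 : B`_0 = 1 by rewrite BE.
have Bs0 : Bs`_0 = 1 by rewrite BsE.
have := count_good_ext B0 Bs0 low top r (l := [:: (true, true)]) isT.
rewrite !coef_bpoly /= => /(_ erefl erefl).
set c := count _ _.
have w3 l j : (slope_weight B Bs l j <= 3)%N.
  by rewrite /slope_weight; case: eqP => // _; case: eqP.
rewrite big_ord_recr /= add1n.
have -> : slope_weight B Bs [:: (true, true)] e.+1 = 2.
  have one : bpoly [:: true] = 1.
    by apply/polyP => -[|i]; rewrite coef_bpoly coef1 //= nth_nil.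
  by rewrite /slope_weight /slope [unzip1 _]/= [unzip2 _]/= one mul1r top.
rewrite expnSr !mulnA leq_pmul2r // => H.
have {}H : (c * 2 ^ e <= 3 ^ r * 3 ^ e)%N.
  apply: leq_trans H _; rewrite leq_mul2l; apply/orP; right.
  by rewrite -[e in (3 ^ e)%N]card_ord -prod_nat_const; apply: leq_prod.
rewrite expr_div_n mulrA ler_pdivlMr ?exprn_gt0 //.
by rewrite -!natrX -!natrM ler_nat.
Qed.

(** Two of the four first pairs are asymmetric and give [4 ^+ r] each; the two symmetric ones each
    give [3 / 2] times the previous sum. The constant 2 is reproduced exactly:
    [2 + 2 * (3 / 2) * 2 = 2 * 4]. *)
Lemma sum_find_asym r :
  \sum_(l <- words (bool * bool)%type r | has asym l) (3 / 2) ^+ find asym l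
    <= 2 * 4 ^+ r :> rat.
Proof.
elim: r => [|r IHr]; first by rewrite /= big_cons big_nil.
have all1 : \sum_(l <- words (bool * bool)%type r) (1 : rat) = 4 ^+ r.
  by rewrite big_const_seq count_predT size_words card_prod card_bool iter_addr_0 natrX.
have shift : \sum_(l <- words (bool * bool)%type r)
      (if has asym l then (3 / 2) ^+ (find asym l).+1 else 0 : rat)
    <= 3 / 2 * (2 * 4 ^+ r).
  rewrite -big_mkcond /=; under eq_bigr do rewrite exprS.
  by rewrite -mulr_sumr ler_wpM2l.
rewrite big_mkcond big_allpairs_dep /= big_enum big_bool2 /=.
rewrite all1 exprS; lra.
Qed.

(** * Counting the exceptional polynomials *)

(* For each [B], only the [A] passing the test modulo 4 on their outer pairs. *)
Definition candidates (n k : nat) : seq {poly int} :=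
  let word (x : seq (bool * bool) * seq bool) := unfold_word ((true, true) :: x.1) x.2 in
  [seq lift01 int (bpoly (word a) * bpoly (word b))
     | b <- [seq (l, c) | l <- [seq l <- words (bool * bool)%type (outer_size (n - k)) | has asym l],
                          c <- words bool (odd (n - k).+1)],
       a <- [seq (l, c) | l <- [seq l <- words (bool * bool)%type (outer_size k)
                                  | good_prefix (bpoly (word b)) (bpoly (rev (word b)))
                                      ((true, true) :: l)],
                          c <- words bool (odd k.+1)]].

Lemma size_candidates n k : (0 < k < n)%N ->
  (size (candidates n k))%:R <= 2 ^+ n.-1 * (3 / 4) ^+ outer_size k :> rat.
Proof.
case/andP=> k0 kn; set m := (n - k)%N.
have m0 : (0 < m)%N by rewrite subn_gt0.
pose K : rat := 2 ^+ odd k.+1 * 3 ^+ outer_size k.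
have K0 : 0 <= K by rewrite mulr_ge0 // exprn_ge0.
rewrite /candidates size_allpairs_dep sumnE big_map big_allpairs_dep /= big_filter.
rewrite natr_sum; apply: (@le_trans _ _ (\sum_(l <- words (bool * bool)%type (outer_size m) | has asym l)
    K * 2 ^+ odd m.+1 * (3 / 2) ^+ find asym l)).
  apply: ler_sum => lb hlb; rewrite natr_sum.
  apply: (@le_trans _ _ (\sum_(c <- words bool (odd m.+1)) K * (3 / 2) ^+ find asym lb)).
    apply: ler_sum => cb _; rewrite size_allpairs size_words card_bool size_filter.
    rewrite natrM natrX mulrC -mulrA ler_wpM2l ?exprn_ge0 //.
    exact: count_good_prefix.
  rewrite big_const_seq count_predT size_words card_bool iter_addr_0 -[X in X <= _]mulr_natr.
  by rewrite natrX mulrAC.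
rewrite -mulr_sumr; apply: le_trans (ler_wpM2l _ (sum_find_asym _)) _.
  by rewrite mulr_ge0 // exprn_ge0.
(* With both extreme coefficients equal to 1, [j.-1] bits remain: two per outer pair, plus the
   middle one if any. *)
have E2 j : (0 < j)%N -> 2 ^+ odd j.+1 * 4 ^+ outer_size j = 2 ^+ j.-1 :> rat.
  move=> j0; rewrite -(outer_sizeE j0) exprD -muln2 mulnC exprM mulrC.
  by congr (_ ^+ _ * _).
have -> : (2 : rat) ^+ n.-1 = 2 * (2 ^+ k.-1 * 2 ^+ m.-1).
  by rewrite -exprD -exprS; congr (_ ^+ _); rewrite /m; lia.
rewrite -!E2 // /K expr_div_n le_eqVlt; apply/orP; left; apply/eqP.
by field; rewrite expf_neq0.
Qed.

Lemma autocorr4W (M N : nat) (B Bs A As : {poly 'F_2}) : (M <= N)%N ->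
  autocorr4 N B Bs A As -> autocorr4 M B Bs A As.
Proof.
move=> MN /forallP h; apply/forallP => -[i iM].
exact: (h (Ordinal (leq_trans iM MN))).
Qed.

Lemma mem_candidates (k m : nat) (A B : {poly 'F_2}) :
    (0 < k)%N -> size A = k.+1 -> size B = m.+1 -> A`_0 = 1 -> B`_0 = 1 ->
    revn m B != B -> autocorr4 k B (revn m B) A (revn k A) ->
  lift01 int (A * B) \in candidates (k + m) k.
Proof.
move=> k0 sA sB A0 B0 Bn h.
have m0 : (0 < m)%N.
  by case: m sB Bn {h} => // sB; rewrite revn0 ?sB ?eqxx.
have [lb [cb [lbw cbw BE]]] := bpoly_unfold_surj m0 sB B0.
have [la [ca [law caw AE]]] := bpoly_unfold_surj k0 sA A0.
have sz j l (c : seq bool) : (0 < j)%N -> l \in words (bool * bool)%type (outer_size j) ->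
    c \in words bool (odd j.+1) -> size (unfold_word ((true, true) :: l) c) = j.+1.
  move=> j0; rewrite !mem_words size_unfold_word => /eqP /= -> /eqP ->.
  by have := outer_sizeE j0; rewrite /=; lia.
have sb := sz _ _ _ m0 lbw cbw; have sa := sz _ _ _ k0 law caw.
have BsE : revn m B = bpoly (rev (unfold_word ((true, true) :: lb) cb)).
  by rewrite BE revn_bpoly.
apply/allpairsPdep; exists (lb, cb), (la, ca); split => /=; last by rewrite AE BE.
- apply/allpairsPdep; exists lb, cb; split=> //; rewrite ?addKn //.
  rewrite mem_filter lbw andbT; apply: contraR Bn => nh.
  rewrite BsE BE unfold_word_palindrome //.
  by move: cbw; rewrite mem_words => /eqP->; case: odd.
- apply/allpairsPdep; exists la, ca; split=> //.
  rewrite mem_filter law andbT -BE -BsE /good_prefix.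
  have sla : size la = outer_size k by apply/eqP; rewrite -mem_words.
  (* The prefix test concerns coefficients below [(outer_size k).+1 <= k], where the words agree
     with [A] and its reversal. *)
  apply: (@autocorr4_agree _ _ _ A (revn k A)).
  + by move=> i ii; rewrite AE /unfold_word -agree_bpoly_cat // size_map.
  + move=> i ii; rewrite AE revn_bpoly // rev_unfold_word -agree_bpoly_cat //.
    by rewrite size_map.
  + apply: autocorr4W h; rewrite /= sla /outer_size.
    by have := outer_sizeE k0; rewrite /outer_size; lia.
Qed.

Lemma sum_geometric_half (r : rat) (a b : nat) : 0 <= r <= 1 -> (a <= b)%N ->
  (1 - r) * (\sum_(a <= j < b) r ^+ j./2) <= 2 * r ^+ a./2.
Proof.
case/andP=> r0 r1 ab.
(* The sum telescopes: from [j] to [j.+1], [g] only replaces [r ^+ j./2] by [r ^+ (j./2).+1]. *)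
pose g j := r ^+ j./2 + r ^+ uphalf j.
have g0 j : 0 <= g j by rewrite addr_ge0 // exprn_ge0.
have -> : (1 - r) * (\sum_(a <= j < b) r ^+ j./2) = g a - g b.
  rewrite -[RHS]opprB -(telescope_sumr g) // mulr_sumr -sumrN.
  by apply: eq_bigr => j _; rewrite /g /= exprS; ring.
apply: le_trans (_ : g a <= _); first by rewrite gerBl.
rewrite mulr2n mulrDl mul1r lerD2l uphalf_half exprD ler_piMl ?exprn_ge0 //.
exact: exprn_ile1.
Qed.

(** * Passage from the integers to ['Z_4] and ['F_2] *)

Lemma lift01_intr (R : comNzRingType) (f : {poly 'F_2}) :
  map_poly intr (lift01 int f) = lift01 R f.
Proof.
apply/polyP => i; rewrite coef_map !coef_lift01 /=.
by rewrite -[RHS]mulrz_nat.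
Qed.

Lemma lift01_F2 (f : {poly 'F_2}) : lift01 'F_2 f = f.
Proof. by apply/polyP => i; rewrite coef_lift01 natr_Zp. Qed.

(** Any ring killed by [m] is allowed, so that a congruence modulo 4 yields identities over both
    ['Z_4] and ['F_2]. *)
Lemma eqpmod_intr (R : comNzRingType) (m : int) (f g : {poly int}) :
  m%:~R = 0 :> R -> eqpmod m f g -> map_poly intr f = map_poly intr g :> {poly R}.
Proof.
move=> m0 /eqpmodP fg; apply/polyP => i; rewrite !coef_map /=.
rewrite [f`_i](divz_eq _ m) [g`_i](divz_eq _ m) fg.
by rewrite !intrD !intrM m0 !mulr0.
Qed.

Lemma calP_lift01 n (P : {poly int}) : (0 < n)%N -> P \in calP n ->
  exists p : {poly 'F_2}, [/\ P = lift01 int p, size p = n.+1, p`_0 = 1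
    & recip_poly P = lift01 int (revn n p)].
Proof.
move=> n0 /calPP [b PE].
pose p := bpoly (mkseq (fun j => [|| j == 0, j == n | b j]%N) n.+1).
have pE i : p`_i = if (i <= n)%N then ([|| i == 0, i == n | b i]%N : nat)%:R else 0.
  rewrite coef_bpoly; case: leqP => ni; first by rewrite nth_mkseq.
  by rewrite nth_default // size_mkseq.
have Pp : P = lift01 int p.
  apply/polyP => i; rewrite coef_lift01 pE PE !coefD coef1 coefXn coef_sum.
  have [/andP[i1 iN]|Hi] := boolP ((1 <= i) && (i < n))%N.
    rewrite (ltnW iN) (bigD1_seq i) ?mem_index_iota ?i1 ?iota_uniq //=.
    rewrite big1 => [|j /negPf ji]; last by rewrite coefZ coefXn eq_sym ji mulr0.
    rewrite coefZ coefXn eqxx mulr1 [i == n]ltn_eqF // [i == 0%N]gtn_eqF //=.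
    by case: (b i).
  rewrite big_nat big1 => [|j jn]; last first.
    by rewrite coefZ coefXn; case: eqP => [ij|_]; rewrite ?mulr0 // ij jn in Hi *.
  case: (ltngtP i n) Hi => [iN|ni|->]; rewrite ?andbT -?leqNgt ?addr0 ?add0r //.
  - by rewrite leqn0 => /eqP-> .
  - by case: i ni.
  - by rewrite [n == 0%N]gtn_eqF // eqxx add0r.
have spn : size p = n.+1.
  apply/eqP; rewrite eqn_leq; apply/andP; split.
    by apply/leq_sizeP => j nj; rewrite pE leqNgt nj.
  rewrite ltnNge; apply/negP => /leq_sizeP/(_ n (leqnn n)).
  by rewrite pE leqnn eqxx orbT.
exists p; split=> //.
(* The leading coefficient 1 fixes the size of [P], so its reversal is the one in degree [n]. *)
have sP : size P = n.+1.
  rewrite Pp size_map_poly_id0 // lead_coefE spn /=.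
  by rewrite (size_lead_F2 spn).
rewrite recip_polyE sP; apply/polyP => i; rewrite coef_poly coef_lift01 coef_revn ltnS.
by case: leqP => // ni; rewrite Pp coef_lift01.
Qed.

Lemma bad_mem_candidates n (P Q : {poly int}) : (0 < n)%N ->
    P \in calP n -> Q \in calP n -> Q != P -> Q != recip_poly P ->
    eqpmod 4 (Q * recip_poly Q) (P * recip_poly P) ->
  exists2 k, (n./2 + odd n <= k < n)%N & P \in candidates n k.
Proof.
move=> n0 /(calP_lift01 n0)[p [-> sp p0 ->]] /(calP_lift01 n0)[q [-> sq q0 ->]].
move=> QP QPs eqPQ.
have eqR (R : comNzRingType) : 4%:~R = 0 :> R ->
    lift01 R p * lift01 R (revn n p) = lift01 R q * lift01 R (revn n q).
  move=> R4; have := eqpmod_intr R4 eqPQ.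
  by rewrite !rmorphM /= !lift01_intr.
have e2 : p * revn n p = q * revn n q.
  have := eqR 'F_2; rewrite !lift01_F2; apply; exact: val_inj.
have [k [m [A [B [kmn [sA sB] [A0 B0] [pE qE]]]]]] := F2_reciprocal_factor sp sq p0 q0 e2.
have psE : revn n p = revn k A * revn m B by rewrite pE -kmn revnM ?sA ?sB.
have qsE : revn n q = revn k A * B.
  by rewrite qE -kmn revnM ?sA ?size_revn // revnK ?sB.
have cond N : autocorr4 N B (revn m B) A (revn k A).
  apply/forallP => i; have /eqR : 4%:~R = 0 :> 'Z_4 by exact: val_inj.
  by rewrite psE qsE pE qE => ->.
(* A self-reciprocal [B] would give [Q = P], and a self-reciprocal [A] would give
   [Q = recip_poly P]. *)
have Bn : revn m B != B by apply: contra QP => /eqP e; rewrite pE qE e.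
have An : revn k A != A by apply: contra QPs => /eqP e; rewrite psE qE e.
have pos j (f : {poly 'F_2}) : size f = j.+1 -> revn j f != f -> (0 < j)%N.
  by case: j => // sf; rewrite revn0 ?sf ?eqxx.
have [k0 m0] := (pos _ _ sA An, pos _ _ sB Bn).
case: (leqP m k) => mk.
  exists k; first by have := odd_double_half n; lia.
  by rewrite pE -kmn; apply: mem_candidates.
exists m; first by have := odd_double_half n; lia.
rewrite pE mulrC -kmn addnC; apply: mem_candidates => //.
by rewrite autocorr4_swap.
Qed.

Theorem theorem1p3 (n : nat) (hn : (1 <= n)%N) :
  uniform_prob (calP n)
    (fun P : {poly int} =>
       [exists Q : (calP n `\` [fset P; recip_poly P])%fset,
          eqpmod 4 (val Q * recip_poly (val Q)) (P * recip_poly P)])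
  <= 8 * (3 / 4) ^+ ((n - 1) %/ 4).
Proof.
(* [h] is the ceiling of [n / 2], the least possible degree of the larger factor. *)
set h := (n./2 + odd n)%N.
have hE : (h + n./2 = n)%N by rewrite /h -[RHS]odd_double_half -addnn; lia.
rewrite /uniform_prob card_calP natrX ler_pdivrMr ?exprn_gt0 //.
set bad := [fset _ in _ | _]%fset.
have badP : (#|` bad| <= size (flatten [seq candidates n k | k <- index_iota h n]))%N.
  apply: uniq_leq_size; first exact: fset_uniq.
  move=> P; rewrite !inE => /andP[PC /existsP[Q]].
  have := fsvalP Q; rewrite !inE negb_or => /andP[/andP[QP QPs] QC] e.
  have [k kn Pk] := bad_mem_candidates hn PC QC QP QPs e.
  by apply/flatten_mapP; exists k => //; rewrite mem_index_iota.
apply: (@le_trans _ _ (size (flatten [seq candidates n k | k <- index_iota h n]))%:R).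
  by rewrite ler_nat.
rewrite size_flatten /shape -map_comp sumnE big_map natr_sum big_nat.
have h0 : (0 < h)%N by lia.
apply: (@le_trans _ _ (\sum_(h <= k < n) 2 ^+ n.-1 * (3 / 4) ^+ outer_size k)).
  rewrite [leRHS]big_nat; apply: ler_sum => k /andP[hk kn].
  by apply: size_candidates; lia.
rewrite -mulr_sumr mulrC ler_pM2r ?exprn_gt0 //.
have -> : \sum_(h <= k < n) (3 / 4) ^+ outer_size k
    = \sum_(h.-1 <= j < n.-1) (3 / 4) ^+ j./2 :> rat.
  by rewrite -{1}(prednK h0) -{1}(prednK hn) big_add1.
have -> : ((n - 1) %/ 4)%N = (h.-1)./2 by rewrite /h; lia.
have r01 : 0 <= (3 / 4 : rat) <= 1 by [].
have hn1 : (h.-1 <= n.-1)%N by lia.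
(* The constant 8 is [2 / (1 - 3 / 4)]. *)
have := sum_geometric_half r01 hn1; lra.
Qed.
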